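(* Let $q = p^r$ and suppose that $r \leq 4$ or $\ell > (q-1)/2$. Let $\alpha, \beta$ be voltage assignments such that $X^\alpha$ and $X^\beta$ are isomorphic as graphs. Then there exists a graph isomorphism $f \colon X^\alpha \to X^\beta$ of the form $f(x,i) = (t x^\sigma, n i)$ for some $t \in \mathbf{F}_q^{\boxtimes}$, $\sigma \in \mathrm{Gal}(\mathbf{F}_q/\mathbf{F}_p)$, $n \in (\mathbf{Z}/\ell)^\times$. Moreover, $n\alpha(s) = \beta(t s^\sigma)$ for all $s \in \mathbf{F}_q^{\boxtimes}$, and $X^{n\alpha}$ and $X^\beta$ are isomorphic as $\mathbf{Z}/\ell$-covering graphs.
   Context: Let $\mathbf{F}_q$ be a finite field of characteristic $p$, $q = p^r \equiv 1 \pmod 4$, $\mathbf{F}_q^{\boxtimes}$ the set of nonzero squares, and $\ell \neq p$ a prime. A voltage assignment is a function $\alpha \colon \mathbf{F}_q^{\boxtimes} \to \mathbf{Z}/\ell$, not identically zero, with $\alpha(-s) = -\alpha(s)$. The graph $X^\alpha$ has vertex set $\mathbf{F}_q \times \mathbf{Z}/\ell$, with $(x,i)$ adjacent to $(y,j)$ iff $y - x \in \mathbf{F}_q^{\boxtimes}$ and $j - i = \alpha(y-x)$; equivalently it is the Cayley graph of $\mathbf{F}_q^+ \times \mathbf{Z}/\ell$ with connection set $S^\alpha = \{(s,\alpha(s)) : s \in \mathbf{F}_q^{\boxtimes}\}$. It covers the Paley graph via $(x,i) \mapsto x$, and $\mathbf{Z}/\ell$ acts by $j \cdot (x,i) = (x,i+j)$.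 For $n \in (\mathbf{Z}/\ell)^\times$, $n\alpha$ is the voltage assignment $s \mapsto n\alpha(s)$. An isomorphism of $\mathbf{Z}/\ell$-covering graphs $X^\alpha \to X^\beta$ is a graph isomorphism $f$ with $f(x,i+j) = f(x,i) + (0,j)$ for all $x,i,j$. *)

(* Defs.v *)
From HB Require Import structures.
From mathcomp Require Import all_boot all_order all_algebra.
Set Implicit Arguments. Unset Strict Implicit. Unset Printing Implicit Defensive.
Import GRing.Theory.
Local Open Scope ring_scope.

Section PaleyCovers.
Variables (F : finFieldType) (l : nat).

Definition nzsq (s : F) : bool := (s != 0) && [exists y : F, y ^+ 2 == s].

(* alpha : F -> 'Z_l, only its values on the nonzero squares matter *)
Definition voltage (alpha : F -> 'Z_l) : Prop :=
  (exists s, nzsq s && (alpha s != 0)) /\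
  (forall s, nzsq s -> alpha (- s) = - alpha s).

Definition Xadj (alpha : F -> 'Z_l) (u v : F * 'Z_l) : bool :=
  nzsq (v.1 - u.1) && (v.2 - u.2 == alpha (v.1 - u.1)).

Definition graph_iso (alpha beta : F -> 'Z_l) (f : F * 'Z_l -> F * 'Z_l) : Prop :=
  bijective f /\ forall u v, Xadj beta (f u) (f v) = Xadj alpha u v.

Definition graph_isomorphic (alpha beta : F -> 'Z_l) : Prop :=
  exists f, graph_iso alpha beta f.

Definition cover_iso (alpha beta : F -> 'Z_l) (f : F * 'Z_l -> F * 'Z_l) : Prop :=
  graph_iso alpha beta f /\
  forall x i j, f (x, i + j) = ((f (x, i)).1, (f (x, i)).2 + j).

Definition cover_isomorphic (alpha beta : F -> 'Z_l) : Prop :=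
  exists f, cover_iso alpha beta f.

End PaleyCovers.

(* Main.v *)
Require Import Defs.
From HB Require Import structures.
From mathcomp Require Import all_boot all_order all_algebra.
From mathcomp Require Import all_fingroup all_solvable all_field zify ring.
Set Implicit Arguments. Unset Strict Implicit. Unset Printing Implicit Defensive.
Import GRing.Theory Num.Theory.
Local Open Scope ring_scope.

(** The translations of F x Z/l commute, so in characteristic l the l-th power of
    the adjacency matrix of X^alpha is the adjacency matrix of the Cayley graph of
    {(l s, 0) : s a nonzero square}.  Hence a graph isomorphism f permutes the
    layers F x {i} and acts on each of them by a map preserving the quadratic
    character of differences, which by Carlitz's theorem is x |-> t_i x^sigma_i + c_i.

    If two layers are joined by edges, the additive map t_j x^sigma_j - t_i x^sigma_i
    takes a coset of its image L into the squares, so |L| < sqrt q; were it nonzero,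
    its kernel would lie in a line over a proper subfield and |L| >= sqrt q.  Thus
    all layers share the same linear part t x^sigma, which may be removed.

    The automorphisms of the form (x, i) |-> (x + c_i, pi i) form a group whose order
    divides a power of p times l!, so the deck group Z/l is a Sylow l-subgroup of it.
    By Sylow's theorem f can be corrected so as to normalize Z/l, and it is then
    (x, i) |-> (x + c, n i + d).

    Carlitz's theorem follows Redei: prod_x (X - (f x - y x)) is lacunary and splits,
    so the power sums of f x - y x vanish, whence the reduced polynomial of f and of
    all its Frobenius twists has no exponent e > 1 prime to p; f is thus a linearized
    polynomial.  Comparing coefficients in (f x - f y)^m = (x - y)^m, m = (q - 1)/2,
    leaves a single monomial. *)

(** * Power sums over a finite field *)

Section PowerSums.
Variable F : finFieldType.
Implicit Types (x y a : F) (P : {poly F}).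

Lemma card_field_gt1 : (1 < #|F|)%N.
Proof. exact: card_finNzRing_gt1. Qed.

Lemma expf_card_pred x : x != 0 -> x ^+ #|F|.-1 = 1.
Proof.
move=> x0; apply: (mulfI x0); rewrite mulr1 -exprS prednK ?expf_card //.
exact: ltnW card_field_gt1.
Qed.

Lemma expf_cardD x k : (0 < k)%N -> x ^+ (k + #|F|.-1) = x ^+ k.
Proof.
move=> k0; have [->|x0] := eqVneq x 0; last by rewrite exprD expf_card_pred ?mulr1.
by rewrite !expr0n addn_eq0; case: k k0.
Qed.

Lemma poly_eq0_all_roots P : (size P <= #|F|)%N -> (forall x, P.[x] = 0) -> P = 0.
Proof.
move=> sP P0; apply/eqP/contraT => nzP.
have /(_ _ (enum_uniq _)) := max_poly_roots nzP (rs := enum F).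
by rewrite -cardE ltnNge sP; apply; apply/allP => x _; apply/eqP/P0.
Qed.

Lemma sum_natr_card : \sum_(x : F) 1 = 0 :> F.
Proof.
apply: (@addrI _ (\sum_(x : F) x)); rewrite addr0 -big_split /=.
by rewrite [RHS](reindex_inj (addIr 1)).
Qed.

(** For k > 0, scaling the variable by some nonzero g with g^k != 1 multiplies the sum by g^k.
    Without such a g, X^(k+1) - X would be a nonzero polynomial of degree less than q with q
    roots. *)
Lemma sum_expf_lt k : (k < #|F|.-1)%N -> \sum_(x : F) x ^+ k = 0.
Proof.
case: k => [|k] ltk; first by under eq_bigr do rewrite expr0; apply: sum_natr_card.
have [/existsP[g /andP[g0 gk]]|/existsPn Hg] := boolP [exists g : F, (g != 0) && (g ^+ k.+1 != 1)].
  have : (g ^+ k.+1 - 1) * \sum_(x : F) x ^+ k.+1 = 0.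
    rewrite mulrBl mul1r [X in _ - X](reindex_inj (mulfI g0)) mulr_sumr.
    by under [X in _ - X]eq_bigr do rewrite exprMn; rewrite subrr.
  by move/eqP; rewrite mulf_eq0 subr_eq0 (negPf gk) => /eqP.
have X0 : ('X^(k.+2) - 'X : {poly F}) = 0.
  apply: poly_eq0_all_roots => [|x].
    rewrite size_polyDl ?size_polyXn ?size_polyN ?size_polyX //; lia.
  rewrite !hornerE; have [->|x0] := eqVneq x 0; first by rewrite expr0n subrr.
  by move: (Hg x); rewrite x0 negbK /= => /eqP xk; rewrite exprS xk mulr1 subrr.
have := size_polyXn F k.+2; move/eqP: X0; rewrite subr_eq0 => /eqP ->.
by rewrite size_polyX.
Qed.

Lemma sum_expf_card_pred : \sum_(x : F) x ^+ #|F|.-1 = -1.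
Proof.
have q1 := card_field_gt1.
rewrite (bigD1 (0 : F)) //= expr0n; have -> : (#|F|.-1 == 0)%N = false by lia.
rewrite add0r (eq_bigr (fun=> 1)) => [|x /expf_card_pred //].
by have := sum_natr_card; rewrite (bigD1 (0 : F)) //= => /eqP; rewrite addrC addr_eq0 => /eqP.
Qed.

(** The power sum of exponent j + (q - 1) - e is -1 for j = e and 0 otherwise. For j > e, the
    exponent is first lowered to j - e, which [0 < e] keeps between 1 and q - 2. *)
Lemma sum_horner_expf P e : (size P <= #|F|)%N -> (0 < e < #|F|)%N ->
  \sum_(x : F) P.[x] * x ^+ (#|F|.-1 - e) = - P`_e.
Proof.
move=> sP /andP[e0 eq].
under eq_bigr do rewrite (horner_coef_wide _ sP) mulr_suml.
rewrite exchange_big /= (bigD1 (Ordinal eq)) //= [X in _ + X]big1 ?addr0 => [|j nje].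
  under eq_bigr do rewrite -mulrA -exprD.
  rewrite -mulr_sumr; have -> : (e + (#|F|.-1 - e) = #|F|.-1)%N by lia.
  by rewrite sum_expf_card_pred mulrN1.
under eq_bigr do rewrite -mulrA -exprD.
rewrite -mulr_sumr; have [lt|ge] := ltnP (j + (#|F|.-1 - e)) #|F|.-1.
  by rewrite sum_expf_lt ?mulr0.
have ej : (e < j)%N.
  by rewrite ltn_neqAle; apply/andP; split; [rewrite eq_sym | lia].
have ltj : (j < #|F|)%N := ltn_ord j.
have ltje : (j - e < #|F|.-1)%N by clear -ltj e0 ej; lia.
under eq_bigr => x _.
  have -> : (j + (#|F|.-1 - e) = (j - e) + #|F|.-1)%N by lia.
  rewrite expf_cardD ?subn_gt0 //. over.
rewrite sum_expf_lt ?mulr0 //.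
Qed.

Lemma interpolation (f : F -> F) :
  exists P, (size P <= #|F|)%N /\ forall x, P.[x] = f x.
Proof.
have q1 := card_field_gt1.
(* 1 - (x - a)^(q - 1) is the indicator function of a. *)
exists (\sum_a f a *: (1 - ('X - a%:P) ^+ #|F|.-1)); split.
  apply: (leq_trans (size_sum _ _ _)); apply/bigmax_leqP => a _.
  apply: (leq_trans (size_scale_leq _ _)); apply: (leq_trans (size_polyD _ _)).
  by rewrite size_polyN size_exp_XsubC size_poly1; lia.
move=> x; rewrite horner_sum (bigD1 x) //= big1 => [|a nax].
  by rewrite !hornerE subrr expr0n; case: #|F| q1 => [|[|n]] //=; rewrite subr0 mulr1 ?addr0.
by rewrite !hornerE expf_card_pred ?subrr ?mulr0 // subr_eq0 eq_sym.
Qed.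

End PowerSums.

(** * The quadratic character *)

Section QuadraticCharacter.
Variable F : finFieldType.
Hypothesis oddF : odd #|F|.
Implicit Types (x y z c d : F).

Lemma card_half : #|F| = (#|F|.-1./2.*2).+1.
Proof. have := card_field_gt1 F; have := oddF; lia. Qed.

Lemma neg1_neq1 : -1 != 1 :> F.
Proof.
apply/eqP => N1; have := sum_natr_card F; rewrite big_const iter_addr_0.
rewrite -[#|_|]/#|F| card_half mulrS -muln2 mulnC mulrnA mulr2n -[X in X + 1]N1 addNr mul0rn addr0.
by apply/eqP/oner_neq0.
Qed.

Lemma expf_half_sqr x : x != 0 -> (x ^+ #|F|.-1./2) ^+ 2 = 1.
Proof.
by move=> x0; rewrite -exprM muln2 -[X in _ ^+ X]succnK -card_half expf_card_pred.
Qed.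

Lemma expf_half_cases x : x != 0 -> x ^+ #|F|.-1./2 = 1 \/ x ^+ #|F|.-1./2 = -1.
Proof. by move=> /expf_half_sqr/eqP; rewrite sqrf_eq1 => /orP[]/eqP; [left|right]. Qed.

Lemma half_gt0 : (0 < #|F|.-1./2)%N.
Proof. have := card_field_gt1 F; have := oddF; lia. Qed.

Lemma card_expf_half_eq1 :
  (#|[set x : F | x ^+ #|F|.-1./2 == 1%R]| <= #|F|.-1./2)%N.
Proof.
have m0 := half_gt0.
have nz : ('X^(#|F|.-1./2) - 1 : {poly F}) != 0 by rewrite -size_poly_eq0 size_XnsubC.
rewrite -ltnS -(size_XnsubC (1 : F) m0) cardE max_poly_roots ?enum_uniq //.
by apply/allP => x; rewrite mem_enum inE rootE !hornerE subr_eq0.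
Qed.

(** Euler's criterion: nonzero squares are roots of X^m - 1, which has at most m roots, and
    squaring, at most two-to-one on 2m elements, takes at least m values. *)
Lemma nzsqE d : nzsq d = (d ^+ #|F|.-1./2 == 1).
Proof.
set m := #|F|.-1./2.
pose A := [set x : F | nzsq x]; pose B := [set x : F | x ^+ m == 1].
have sAB : A \subset B.
  apply/subsetP => x; rewrite !inE => /andP[x0 /existsP[y /eqP yx]].
  rewrite -yx -exprM mulnC exprM expf_half_sqr //.
  by apply: contraNneq x0 => y0; rewrite -yx y0 expr0n.
have leB : (#|B| <= m)%N := card_expf_half_eq1.
have leA : (m <= #|A|)%N.
  have : (#|[set x : F | x != 0%R]| <= 2 * #|A|)%N.
    rewrite -sum1_card (partition_big_imset (fun x => x ^+ 2)) /=.
    have -> : ((fun x => x ^+ 2) @: [set x : F | x != 0%R]) = A.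
      apply/setP => y; apply/imsetP/idP => [[x]|]; rewrite !inE /nzsq.
        by move=> x0 ->; rewrite expf_neq0 //; apply/existsP; exists x.
      case/andP=> y0 /existsP[x /eqP xy]; exists x; rewrite ?inE //.
      by apply: contraNneq y0 => x0; rewrite -xy x0 expr0n.
    rewrite mulnC -sum_nat_const leq_sum // => y; rewrite inE => /andP[_ /existsP[x /eqP <-]].
    rewrite sum1_card; apply: (@leq_trans #|[set x; - x]|); last by rewrite cards2; case: eqP.
    by apply/subset_leq_card/subsetP => z; rewrite !inE !unfold_in => /andP[_]; rewrite eqf_sqr.
  have -> : [set x : F | x != 0%R] = [set~ 0] by apply/setP => x; rewrite !inE.
  rewrite cardsC1 card_half -/m; lia.
have /eqP AB : A == B by rewrite eqEcard sAB (leq_trans leB).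
by move/setP/(_ d): AB; rewrite !inE.
Qed.

Lemma nzsq_mull c d : nzsq c -> nzsq (c * d) = nzsq d.
Proof. by rewrite !nzsqE exprMn => /eqP ->; rewrite mul1r. Qed.

(** The quadratic character takes values in [int], so that its second moments can be compared as
    ordered numbers. *)
Definition qchar x : int := if x == 0 then 0 else if nzsq x then 1 else -1.

Lemma qcharM : {morph qchar : x y / x * y}.
Proof.
move=> x y; rewrite /qchar mulf_eq0.
have [//|x0] := eqVneq x 0; first by rewrite mul0r.
have [//|y0] /= := eqVneq y 0; first by rewrite mulr0.
rewrite !nzsqE exprMn.
have [->|->] := expf_half_cases x0; have [->|->] := expf_half_cases y0;
  by rewrite ?mulN1r ?mul1r ?opprK ?eqxx ?(negPf neg1_neq1).
Qed.

Lemma qchar_sqr x : qchar x * qchar x = (x != 0)%:R.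
Proof. by rewrite /qchar; case: eqP => //=; case: ifP. Qed.

Lemma sum_qchar : \sum_x qchar x = 0.
Proof.
have [g g0 gN] : exists2 g : F, g != 0 & ~~ nzsq g.
  apply/exists_inP/contraT; rewrite negb_exists_in => /forall_inP H.
  suff X0 : ('X^((#|F|.-1./2).+1) - 'X : {poly F}) = 0.
    have := size_polyXn F (#|F|.-1./2).+1; move/eqP: X0; rewrite subr_eq0 => /eqP ->.
    rewrite size_polyX; have := card_field_gt1 F; have := oddF; lia.
  apply: poly_eq0_all_roots => [|x].
    have := card_field_gt1 F; have := oddF.
    move=> ? ?; rewrite size_polyDl ?size_polyXn ?size_polyN ?size_polyX //; lia.
  rewrite !hornerE exprS; have [->|x0] := eqVneq x 0; first by rewrite mul0r subrr.
  by move: (H x x0); rewrite negbK nzsqE => /eqP ->; rewrite mulr1 subrr.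
have : \sum_x qchar x = - \sum_x qchar x.
  rewrite {1}(reindex_inj (mulfI g0)) -sumrN; apply: eq_bigr => x _.
  by rewrite qcharM {1}/qchar (negPf g0) (negPf gN) mulN1r.
lia.
Qed.

(** For x != 0 the summand is the character of 1 + c/x, which runs over all elements except 1; the
    full character sum is 0. *)
Lemma sum_qchar_shift c : c != 0 -> \sum_x qchar x * qchar (x + c) = -1.
Proof.
move=> c0; rewrite (bigD1 0) //= {1}/qchar eqxx mul0r add0r.
have : qchar 1 + \sum_(x | x != 0) qchar (c / x + 1) = 0.
  rewrite -[RHS]sum_qchar [RHS](reindex_inj (addIr 1)) [RHS](bigD1 0) //= add0r; congr (_ + _).
  rewrite [RHS](reindex (fun x : F => c / x)) /=; last first.
    exists (fun x => c / x) => x; rewrite inE => x0; rewrite invf_div mulrCA divff ?mulr1 //.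
 by apply: eq_bigl => x; rewrite mulf_eq0 invr_eq0 (negPf c0).
have -> : qchar 1 = 1.
  by rewrite /qchar oner_eq0 nzsqE expr1n eqxx.
move/eqP; rewrite addrC addr_eq0 => /eqP <-; apply: eq_bigr => x x0.
have -> : x + c = x * (c / x + 1) by rewrite mulrDr mulr1 mulrCA divff // mulr1 addrC.
by rewrite qcharM mulrA qchar_sqr x0 mul1r.
Qed.

Lemma sum_qcharM x y :
  \sum_z qchar (z - x) * qchar (z - y) = if x == y then #|F|%:R - 1 else -1.
Proof.
rewrite (reindex_inj (addIr x)) /=; under eq_bigr do rewrite addrK -addrA.
case: eqP => [->|/eqP nxy]; last by rewrite sum_qchar_shift // subr_eq0.
under eq_bigr do rewrite subrr addr0 qchar_sqr.
rewrite (bigD1 0) //= eqxx add0r (eq_bigr (fun=> 1)) => [|z ->] //.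
rewrite sumr_const; have -> : #|[pred i : F | i != 0]| = #|F|.-1.
  by rewrite -(cardC1 (0 : F)).
by have := card_field_gt1 F; case: #|F| => // n _; rewrite -natr1 addrK.
Qed.

(* Second moment of z |-> sum_y qchar (z - M y), which equals q on c + im M. *)
Lemma card_additive_nzsq (M : {additive F -> F}) c :
  (forall x, nzsq (M x + c)) -> (#|M @: F| < #|[set x | M x == 0%R]|)%N.
Proof.
move=> Msq; set L := M @: F; set K := [set x | _].
pose T z := \sum_y qchar (z - M y).
have TE z : z \in [set l + c | l in L] -> T z = #|F|%:R.
  case/imsetP=> l /imsetP[x _ ->] ->; rewrite /T (eq_bigr (fun=> 1)) ?sumr_const //.
  move=> y _; have -> : M x + c - M y = M (x - y) + c by rewrite raddfB addrAC.
  by have := Msq (x - y); rewrite /qchar => /[dup] /andP[/negPf-> _] ->.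
have eqK y : #|[set x | M x == M y]| = #|K|.
  rewrite -(card_imset K (addIr y)); apply: eq_card => x; rewrite inE.
  apply/eqP/imsetP => [xy|[z]]; last by rewrite inE => /eqP Mz ->; rewrite raddfD Mz /= add0r.
  by exists (x - y); rewrite ?subrK // inE raddfB /= xy subrr.
(* By [sum_qcharM] a pair (y, y') contributes q - 1 if M y = M y' and -1 otherwise, so each y
   contributes q|K| - q. *)
have S2 : \sum_z T z ^+ 2 = #|F|%:R ^+ 2 * (#|K|%:R - 1).
  under eq_bigr do rewrite /T expr2 big_distrlr /=.
  rewrite exchange_big /=; under eq_bigr do rewrite exchange_big /=.
  under eq_bigr do under eq_bigr do rewrite sum_qcharM.
  have inner y : \sum_y' (if M y == M y' then #|F|%:R - 1 else -1) = #|F|%:R * (#|K|%:R - 1) :> int.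
    have -> : \sum_y' (if M y == M y' then #|F|%:R - 1 else -1) =
              \sum_y' ((if M y' == M y then #|F|%:R else 0) - 1) :> int.
      by apply: eq_bigr => y' _; rewrite eq_sym; case: ifP => //; rewrite add0r.
    rewrite big_split /= -big_mkcond sumr_const sumr_const -(eqK y).
    rewrite cardsE -[X in X + _]mulr_natl -[X in _ + X]mulr_natl.
    by rewrite -[#|[pred _ | _]|%:R * _]mulrC -mulrDr.
  rewrite (eq_bigr _ (fun y _ => inner y)) sumr_const -mulr_natl; ring.
have : #|F|%:R ^+ 2 * #|L|%:R <= #|F|%:R ^+ 2 * (#|K|%:R - 1) :> int.
  rewrite -S2 (bigID [in [set l + c | l in L]]) /=.
  rewrite (eq_bigr (fun=> #|F|%:R ^+ 2)) => [|z /TE -> //].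
  rewrite sumr_const (card_imset (mem L) (addIr c)) mulr_natr.
  by rewrite lerDl sumr_ge0 // => z _; rewrite sqr_ge0.
rewrite ler_pM2l ?exprn_gt0 ?ltr0n ?(ltnW (card_field_gt1 F)) //.
lia.
Qed.

Lemma card_image_kernel (M : {additive F -> F}) :
  (#|F| <= #|M @: F| * #|[set x | M x == 0%R]|)%N.
Proof.
rewrite -[X in (X <= _)%N]sum1_card (partition_big_imset M) /= -sum_nat_const.
apply: leq_sum => l /imsetP[y _ ->]; rewrite sum1_card.
rewrite -[X in (_ <= X)%N](card_imset _ (addIr y)); apply/subset_leq_card/subsetP => x.
rewrite unfold_in /= => /eqP xy; apply/imsetP; exists (x - y); rewrite ?subrK //.
by rewrite inE raddfB /= xy subrr.
Qed.

Lemma card_proper_semilinear (s1 s2 : {rmorphism F -> F}) (t1 t2 w : F) :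
  t1 * s1 w != t2 * s2 w ->
  (#|[set x | (t1 * s1 x - t2 * s2 x == 0)%R]| ^ 2 <= #|F|)%N.
Proof.
move=> Hw; set K := [set x | _].
have [/existsP[y /andP[y0 yK]]|/existsPn nK] := boolP [exists y, (y != 0) && (y \in K)]; last first.
  have /subset_leq_card : K \subset [set 0].
    apply/subsetP => x xK; rewrite inE; apply: contraT => x0.
    by move: (nK x); rewrite x0 xK.
  rewrite cards1; have := card_field_gt1 F; nia.
(* On the kernel, s1 and s2 agree on ratios; w / y separates them. *)
have kerE x : x \in K -> t1 * s1 x = t2 * s2 x by rewrite inE subr_eq0 => /eqP.
have t10 : t1 != 0.
  apply: contraNneq Hw => t10; move: (kerE y yK); rewrite t10 !mul0r => /esym/eqP.
  by rewrite mulf_eq0 fmorph_eq0 (negPf y0) orbF => /eqP ->; rewrite mul0r.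
have ratio x z : x \in K -> z \in K -> x != 0 -> s1 (z / x) = s2 (z / x).
  move=> xK zK x0; have sx0 : s1 x != 0 by rewrite fmorph_eq0.
  have sx0' : s2 x != 0 by rewrite fmorph_eq0.
  have t20 : t2 != 0.
    by apply: contraNneq (mulf_neq0 t10 sx0) => t20; rewrite kerE // t20 mul0r.
  rewrite !fmorph_div; apply: (mulfI (mulf_neq0 t10 sx0)).
  rewrite {2}kerE // -[LHS]mulrA [s1 x * _]mulrC divfK // kerE //.
  by rewrite -[RHS]mulrA [s2 x * _]mulrC divfK.
have wK : s1 (w / y) != s2 (w / y).
  apply: contra Hw => /eqP e; rewrite -(divfK y0 w).
  by rewrite !(rmorphM _ (w / y) y) e mulrCA kerE // mulrCA.
(* Since w / y is not a ratio of kernel elements, (a, b) |-> a + b (w / y) is injective on K x K,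
   whence |K|^2 <= q. *)
pose g (u : F * F) := u.1 + u.2 * (w / y).
have gK : {in setX K K &, injective g}.
  move=> [a b] [a' b']; rewrite !in_setX /= => /andP[aK bK] /andP[a'K b'K] e.
  have KB u v : u \in K -> v \in K -> u - v \in K.
    move=> uK vK; rewrite inE !rmorphB /= !mulrBr (kerE u) // (kerE v) //.
    by rewrite subrr.
  have eb : b = b'.
    apply/eqP; rewrite -subr_eq0; apply: contraNT wK => b0.
    have -> : w / y = - ((a - a') / (b - b')).
      move: e; rewrite /g /= => e; apply: (mulIf b0); rewrite mulNr divfK //.
      apply/eqP; rewrite -subr_eq0 -(subrr (a' + b' * (w / y))) -{1}e; apply/eqP; ring.
    by rewrite !rmorphN /= ratio ?KB.
  by move: e; rewrite /g /= eb => /addIr ->.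
by rewrite -mulnn -cardsX -(card_in_imset gK) max_card.
Qed.

(** Were the difference M nonzero, |ker M|^2 <= q <= |im M| |ker M| would give |ker M| <= |im M|,
    against the strict inequality from the character sum. *)
Lemma semilinear_diff_nzsq (s1 s2 : {rmorphism F -> F}) (t1 t2 c : F) :
  (forall x, nzsq (t1 * s1 x - t2 * s2 x + c)) -> forall x, t1 * s1 x = t2 * s2 x.
Proof.
move=> H w; apply/eqP/contraT => Hw.
pose M x := t1 * s1 x - t2 * s2 x.
have MB : zmod_morphism M.
  by move=> x y; rewrite /M !rmorphB /=; ring.
pose Madd := GRing.isZmodMorphism.Build F F M MB.
pose M' : {additive F -> F} := HB.pack M Madd.
have /= lt := @card_additive_nzsq M' c H.
have /= le := card_image_kernel M'.
have := leq_trans (card_proper_semilinear Hw) le.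
by rewrite -mulnn leq_pmul2r ?(leq_ltn_trans _ lt) // leqNgt lt.
Qed.

End QuadraticCharacter.

(** * Carlitz's theorem *)

Lemma coef_exp_linear (R : comNzRingType) (c d : R) k j :
  ((c%:P + d *: 'X) ^+ k)`_j = c ^+ (k - j) * d ^+ j *+ 'C(k, j).
Proof.
rewrite exprDn coef_sum.
have [lejk|ltkj] := leqP j k; last first.
  rewrite bin_small // mulr0n big1 // => i _.
  rewrite coefMn -polyC_exp exprZn coefCM coefZ coefXn.
  have -> : (j == i) = false by have := ltn_ord i; lia.
  by rewrite !mulr0 mul0rn.
have ltj : (j < k.+1)%N by [].
rewrite (bigD1 (Ordinal ltj)) //= big1 ?addr0 => [|i ij].
  by rewrite coefMn -polyC_exp exprZn coefCM coefZ coefXn eqxx mulr1.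
rewrite coefMn -polyC_exp exprZn coefCM coefZ coefXn.
have -> : (j == i) = false by apply: contraNF ij => /eqP ji; apply/eqP/val_inj; rewrite /= ji.
by rewrite !mulr0 mul0rn.
Qed.

Lemma size_exp_linear (R : comNzRingType) (c d : R) k :
  (size ((c%:P + d *: 'X) ^+ k) <= k.+1)%N.
Proof.
apply/leq_sizeP => j ltkj; rewrite coef_exp_linear bin_small //.
Qed.

(** Differentiation lowers the multiplicity of a root by at most one, and the product over distinct
    roots restores the missing factor. *)
Lemma dvdp_prod_undup_deriv (F : fieldType) (s : seq F) :
  \prod_(a <- s) ('X - a%:P) %|
    (\prod_(a <- undup s) ('X - a%:P)) * (\prod_(a <- s) ('X - a%:P))^`().
Proof.
elim: s => [|b s IH] /=; first by rewrite big_nil dvd1p.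
rewrite !big_cons derivM derivXsubC mul1r.
set P := \prod_(a <- s) _ in IH *; case: ifP => [bs|_]; last first.
  rewrite big_cons -mulrA dvdp_mul2l ?polyXsubC_eq0 // mulrDr.
  by apply: dvdp_add; [apply: dvdp_mull | rewrite mulrCA; apply: dvdp_mull].
rewrite mulrDr dvdp_add //; last by rewrite mulrCA dvdp_mul2l ?polyXsubC_eq0.
by rewrite dvdp_mul2r ?dvdp_XsubCl ?root_prod_XsubC ?mem_undup // monic_neq0 // monic_prod_XsubC.
Qed.

(** Up to sign the coefficient is the elementary symmetric function of degree n - i in n polynomials
    of degree at most 1. *)
Lemma size_coef_prod_linear (R : idomainType) (I : Type) (s : seq I) (g : I -> {poly R}) i :
  (forall j, (size (g j) <= 2)%N) ->
  (size ((\prod_(j <- s) ('X - (g j)%:P))`_i)%R <= (size s).+1 - i)%N.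
Proof.
move=> sg; elim: s i => [|j s IH] i; first by rewrite big_nil coef1; case: i => [|i];
  rewrite ?size_poly1 ?size_poly0.
rewrite big_cons mulrBl coefB coefXM coefCM.
apply: (leq_trans (size_polyD _ _)); rewrite size_polyN geq_max; apply/andP; split.
  case: i => [|i] /=; first by rewrite size_poly0.
  by rewrite subSS.
have := IH i; set Q := _`_i; have [->|Q0] := eqVneq Q 0; first by rewrite mulr0 size_poly0.
have bound a b n : (a <= 2 -> 0 < b -> b <= n.+1 - i -> (a + b).-1 <= n.+2 - i)%N by lia.
by move=> sQ; rewrite (leq_trans (size_polyMleq _ _)) // bound ?size_poly_gt0.
Qed.

(** * Redei polynomials and power sums of f x - x y *)

Section Redei.
Variable F : finFieldType.
Hypothesis oddF : odd #|F|.
Let m := #|F|.-1./2.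
Variable f : F -> F.
Hypothesis fq : forall x y, (f x - f y) ^+ m = (x - y) ^+ m.

Let m_gt0 : (0 < m)%N := half_gt0 oddF.

Lemma qchar_preserving_inj : injective f.
Proof.
move=> x y e; move: (fq x y); rewrite e subrr expr0n eqn0Ngt m_gt0 => /esym/eqP.
by rewrite expf_eq0 m_gt0 subr_eq0 /= => /eqP.
Qed.

(** A collision makes y a slope (f x - f x') / (x - x'), and all slopes have m-th power 1. *)
Lemma nonsquare_slope_inj y : y ^+ m != 1 -> injective (fun x => f x - x * y).
Proof.
move=> ym x x' e; apply/eqP/contraT => nxx'.
have d0 : (x - x') ^+ m != 0 by rewrite expf_neq0 // subr_eq0.
have e' : f x - f x' = (x - x') * y.
  apply/eqP; rewrite -subr_eq0 -(subrr (f x - x * y)) {2}e; apply/eqP; ring.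
move: (fq x x'); rewrite e' exprMn -[RHS]mulr1 => /(mulfI d0) /eqP.
by rewrite (negPf ym).
Qed.

Lemma card_expf_half_neq1 : (m < #|[set y : F | y ^+ m != 1%R]|)%N.
Proof.
have : (#|[set y : F | y ^+ m == 1%R]| <= m)%N := card_expf_half_eq1 oddF.
have := cardsC [set y : F | y ^+ m == 1%R]; rewrite [X in _ = X]card_half // -/m.
have -> : ~: [set y : F | y ^+ m == 1%R] = [set y : F | y ^+ m != 1%R].
  by apply/setP => y; rewrite !inE.
lia.
Qed.

Definition redei y : {poly F} := \prod_(x <- enum F) ('X - (f x - x * y)%:P).

Lemma size_redei y : size (redei y) = #|F|.+1.
Proof. by rewrite /redei size_prod_XsubC -cardE. Qed.

Lemma prod_XsubC_inj (v : F -> F) : injective v ->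
  \prod_(x <- enum F) ('X - (v x)%:P) = 'X^#|F| - 'X.
Proof. by move=> v_inj; rewrite big_enum finField_genPoly [RHS](reindex_inj v_inj). Qed.

(** As a polynomial in y (the coefficient of [R2]), it has degree at most q - i <= m. It vanishes at
    the more than m values with y^m != 1, where [redei y] is X^q - X. *)
Lemma redei_lacunary y i : (m < i < #|F|)%N -> (redei y)`_i = 0.
Proof.
case/andP=> lti ltiq.
pose g x : {poly F} := (f x)%:P - x *: 'X.
pose R2 : {poly {poly F}} := \prod_(x <- enum F) ('X - (g x)%:P).
have R2E z j : (redei z)`_j = (R2`_j).[z].
  have <- : map_poly (horner_eval z) R2 = redei z; last by rewrite coef_map.
  by rewrite map_prod_XsubC; apply: eq_bigr => x _; rewrite /= /horner_eval !hornerE.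
rewrite R2E; suff -> : R2`_i = 0 by rewrite horner0.
apply/eqP/contraT => nz.
have : (size (R2`_i)%R <= #|F|.+1 - i)%N.
  rewrite /R2 [X in (_ <= X.+1 - _)%N]cardE; apply: size_coef_prod_linear => x.
  rewrite (leq_trans (size_polyD _ _)) // size_polyN geq_max (leq_trans (size_polyC_leq1 _)) //.
  by rewrite (leq_trans (size_scale_leq _ _)) // size_polyX.
have : (#|[set y : F | y ^+ m != 1%R]| < size (R2`_i)%R)%N.
  rewrite cardE max_poly_roots ?enum_uniq //; apply/allP => z.
  rewrite mem_enum inE => zm; rewrite rootE -R2E /redei prod_XsubC_inj; last exact: nonsquare_slope_inj.
  rewrite coefB coefXn coefX; have m0 := m_gt0.
  have -> : (i == #|F|) = false by lia.
  have -> : (i == 1)%N = false by lia.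
  by rewrite subr0.
have := card_expf_half_neq1; have := card_half oddF; rewrite -/m; lia.
Qed.

(** Write R = X^q + g with deg g <= m, so R' = g'. The product of the distinct roots of R divides
    both R and X^q - X, hence their difference g + X; thus R divides (g + X) g', of degree below q,
    which must vanish. *)
Lemma deriv_redei y : redei y = 'X^#|F| - 'X \/ (redei y)^`() = 0.
Proof.
have m0 := half_gt0; have q2m := card_half oddF.
pose g := redei y - 'X^#|F|.
have sg : (size g <= m.+1)%N.
  apply/leq_sizeP => i ltmi; rewrite coefB coefXn.
  have [ltiq|] := ltnP i #|F|; first by rewrite redei_lacunary ?ltmi // (ltn_eqF ltiq) subrr.
  rewrite leq_eqVlt => /orP[/eqP <-|ltqi].
    have /monicP := monic_prod_XsubC (enum F) predT (fun x => f x - x * y).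
    by rewrite -/(redei y) lead_coefE size_redei /= eqxx => ->; rewrite subrr.
  by rewrite nth_default ?size_redei // gtn_eqF // subrr.
have gd : (redei y)^`() = g^`().
  rewrite /g derivB derivXn -[LHS]subr0; congr (_ - _).
  have cF : #|F|%:R = 0 :> F.
    by rewrite -[RHS](sum_natr_card F) sumr_const.
  by rewrite -mulr_natl -polyC_natr cF mul0r.
have dv : redei y %| (g + 'X) * g^`().
  pose s := [seq f x - x * y | x <- enum F].
  have rs : redei y = \prod_(a <- s) ('X - a%:P).
    by rewrite big_map.
  rewrite -gd rs; apply: (dvdp_trans (dvdp_prod_undup_deriv s)); apply: dvdp_mul => //.
  have -> : g + 'X = redei y - ('X^#|F| - 'X) by rewrite /g; ring.
  apply: uniq_roots_dvdp; last by rewrite uniq_rootsE undup_uniq.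
  apply/allP => a; rewrite mem_undup => as_; rewrite rootE !hornerE rs.
  have := as_; rewrite -root_prod_XsubC rootE => /eqP ->.
  by rewrite expf_card subrr subr0.
have : (g + 'X) * g^`() == 0.
  apply: contraT => nz.
  have sgX : (size (g + 'X)%R <= m.+1)%N.
    by rewrite (leq_trans (size_polyD _ _)) // geq_max sg size_polyX.
  have g0 : g != 0.
    by apply: contraNneq nz => ->; rewrite deriv0 mulr0.
  have bound a d s n q : (q = n.*2.+1 -> a <= n.+1 -> s <= n.+1 -> d < s -> (a + d).-1 <= q)%N.
    by lia.
  have := leq_trans (dvdp_leq nz dv) (size_polyMleq _ _).
  by rewrite size_redei ltnNge (bound _ _ _ _ _ q2m sgX sg (lt_size_deriv g0)).
rewrite mulf_eq0 => /orP[/eqP e|/eqP e]; [left|right]; last by rewrite gd.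
by apply/eqP; rewrite -subr_eq0 -e; apply/eqP; rewrite /g; ring.
Qed.

(** Either the values f x - x y permute F, and a plain power sum remains, or R' = 0 and each value
    is taken a multiple of p times. *)
Lemma sum_slope_exp y k : (k < #|F|.-1)%N -> \sum_x (f x - x * y) ^+ k = 0.
Proof.
move=> ltk; pose v x := f x - x * y.
have [e|e] := deriv_redei y.
  have v_surj a : exists x, v x == a.
    have : root (redei y) a by rewrite e rootE !hornerE expf_card subrr.
    rewrite /redei -(big_map (fun x => v x) predT (fun b => 'X - b%:P)) root_prod_XsubC.
    by case/mapP=> x _ ->; exists x.
  have v_inj : injective v.
    suff /imset_injP vI : #|v @: [set: F]| == #|[set: F]| by move=> x x' /vI -> //; rewrite inE.
    rewrite eqn_leq leq_imset_card subset_leq_card //; apply/subsetP => a _.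
    by have [x /eqP <-] := v_surj a; rewrite imset_f.
  by rewrite -[RHS](sum_expf_lt ltk) [RHS](reindex_inj v_inj).
rewrite (partition_big v predT) //= big1 // => a _.
rewrite (eq_bigr (fun=> a ^+ k)) => [|x /eqP <- //].
rewrite sumr_const -mulr_natl; set n := #|_|.
suff -> : n%:R = 0 :> F by rewrite mul0r.
pose W : {poly F} := \prod_(x | v x != a) ('X - (v x)%:P).
have rE : redei y = ('X - a%:P) ^+ n * W.
  rewrite /redei big_enum (bigID (fun x => v x == a)) /=; congr (_ * _).
  by rewrite (eq_bigr (fun=> 'X - a%:P)) ?prodr_const // => x /eqP <-.
have Wa : W.[a] != 0.
  rewrite horner_prod prodf_seq_neq0; apply/allP => x _; apply/implyP => xa.
  by rewrite !hornerE subr_eq0 eq_sym.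
case: n rE => // n rE; move: e; rewrite rE derivM deriv_exp derivXsubC mul1r /=.
have -> : ('X - a%:P) ^+ n *+ n.+1 * W + ('X - a%:P) ^+ n.+1 * W^`() =
          ('X - a%:P) ^+ n * (W *+ n.+1 + ('X - a%:P) * W^`()).
  by rewrite mulrDr mulrnAl mulrnAr exprSr mulrA.
move/eqP; rewrite mulf_eq0 expf_eq0 polyXsubC_eq0 andbF /= => /eqP.
move/(congr1 (fun Q => Q.[a])); rewrite !hornerE subrr mul0r addr0 hornerMn -mulr_natl => /eqP.
by rewrite mulf_eq0 (negPf Wa) orbF => /eqP.
Qed.

(** The k-th power sum is a polynomial in y of degree less than q that vanishes everywhere; this is
    its coefficient of y^(k - 1), up to sign. *)
Lemma sum_moment1 k : (0 < k < #|F|.-1)%N -> k%:R * \sum_x f x * x ^+ k.-1 = 0.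
Proof.
case/andP=> k0 ltk.
pose Q : {poly F} := \sum_x ((f x)%:P + (- x) *: 'X) ^+ k.
have Q0 : Q = 0.
  apply: poly_eq0_all_roots => [|y].
    apply: (leq_trans (size_sum _ _ _)); apply/bigmax_leqP => x _.
    by apply: (leq_trans (size_exp_linear _ _ _)); lia.
  rewrite horner_sum -[RHS](sum_slope_exp y ltk); apply: eq_bigr => x _.
  by rewrite !hornerE mulNr.
have : Q`_k.-1 = 0 by rewrite Q0 coef0.
rewrite coef_sum (eq_bigr (fun x => (-1) ^+ k.-1 * (k%:R * (f x * x ^+ k.-1)))) => [|x _].
  by rewrite -!mulr_sumr => /eqP; rewrite mulf_eq0 signr_eq0 => /eqP.
rewrite coef_exp_linear -subn1 subKn // expr1 (exprNn x) subn1.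
have -> : 'C(k, k.-1) = k by rewrite -{1}(prednK k0) binSn prednK.
by rewrite -[LHS]mulr_natl [f x * (_ * _)]mulrCA [LHS]mulrCA.
Qed.

(** Weight (f x - f y)^m = (x - y)^m by y^(q - 1 - e) and sum over y. The right side extracts the
    coefficient of y^e, a multiple of C(m, e) = 0. The left side is then a polynomial in f x
    vanishing on all of F, so its coefficient of degree m - k is 0. *)
Lemma qchar_preserving_binomial k e : (0 < e < #|F|)%N ->
  'C(m, k)%:R != 0 :> F -> 'C(m, e)%:R = 0 :> F ->
  \sum_y f y ^+ k * y ^+ (#|F|.-1 - e) = 0.
Proof.
move=> he nzk ze; have q2m := card_half oddF.
have lekm : (k <= m)%N by rewrite leqNgt; apply: contraNN nzk => /bin_small ->.
pose Q : {poly F} := \sum_y y ^+ (#|F|.-1 - e) *: ((- f y)%:P + 1 *: 'X) ^+ m.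
have Qf x : Q.[f x] = 0.
  have -> : Q.[f x] = \sum_y ((x%:P + (-1) *: 'X : {poly F}) ^+ m).[y] * y ^+ (#|F|.-1 - e).
    rewrite horner_sum; apply: eq_bigr => y _; rewrite !hornerE mulrC; congr (_ * _).
    by rewrite addrC fq mulN1r.
  rewrite sum_horner_expf //; last by apply: leq_trans (size_exp_linear _ _ _) _; move: q2m; rewrite -/m; lia.
  by rewrite coef_exp_linear -mulr_natl ze mul0r oppr0.
have Q0 : Q = 0.
  apply: poly_eq0_all_roots => [|y].
    apply: (leq_trans (size_sum _ _ _)); apply/bigmax_leqP => y _.
    apply: (leq_trans (size_scale_leq _ _)); apply: leq_trans (size_exp_linear _ _ _) _.
    by move: q2m; rewrite -/m; lia.
  have [f' _ f'K] := injF_bij qchar_preserving_inj.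
  by rewrite -(f'K y) Qf.
have : Q`_(m - k) = 0 by rewrite Q0 coef0.
rewrite coef_sum (eq_bigr (fun y => (-1) ^+ k * ('C(m, k)%:R * (f y ^+ k * y ^+ (#|F|.-1 - e))))) => [|y _].
  rewrite -!mulr_sumr => /eqP; rewrite mulf_eq0 signr_eq0 /= mulf_eq0 (negPf nzk) => /eqP //.
rewrite coefZ coef_exp_linear subKn // expr1n mulr1 (exprNn (f y)) bin_sub // -[X in _ * X]mulr_natl.
by rewrite mulrC mulrCA -!mulrA.
Qed.

End Redei.

(** In characteristic p, (1 + X)^(ap + b) = (1 + X^p)^a (1 + X)^b, and since b, d < p only the term
    i = c reaches X^(cp + d). *)
Lemma lucas_step (R : comNzRingType) p a b c d : p \in [pchar R] ->
  (b < p)%N -> (d < p)%N ->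
  'C(a * p + b, c * p + d)%:R = 'C(a, c)%:R * 'C(b, d)%:R :> R.
Proof.
move=> chp ltb ltd; have p_pr := pcharf_prime chp.
have binE n k : 'C(n, k)%:R = ((1%:P + 1 *: 'X : {poly R}) ^+ n)`_k.
  by rewrite coef_exp_linear !expr1n mulr1.
have frob : (1%:P + 1 *: 'X : {poly R}) ^+ p = 1%:P + 1 *: 'X^p.
  rewrite !scale1r exprDn_pchar ?expr1n //; apply/pnatP; rewrite ?prime_gt0 // => l l_pr.
  by rewrite dvdn_prime2 // => /eqP ->; rewrite pchar_poly.
rewrite [LHS]binE exprD mulnC exprM frob exprDn mulr_suml coef_sum.
have term i : ((1%:P ^+ (a - i) * (1 *: 'X^p : {poly R}) ^+ i *+ 'C(a, i)) *
    (1%:P + 1 *: 'X) ^+ b)`_(c * p + d) =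
    'C(a, i)%:R * (if (c * p + d < p * i)%N then 0 else 'C(b, c * p + d - p * i)%:R).
  rewrite expr1n mul1r scale1r -exprM mulrnAl coefMn coefXnM -binE mulr_natl.
  by case: ifP.
under eq_bigr do rewrite term.
have [leca|ltac] := leqP c a; last first.
  rewrite bin_small // mul0r big1 // => i _; rewrite ifF; last by have := ltn_ord i; nia.
  by rewrite ['C(b, _)]bin_small ?mulr0 //; have := ltn_ord i; nia.
have ltc : (c < a.+1)%N by [].
rewrite (bigD1 (Ordinal ltc)) //= big1 ?addr0 => [|i ic].
  by rewrite ifF; [congr (_ * 'C(_, _)%:R) | ]; nia.
have {ic} : (i < c)%N || (c < i)%N by rewrite -neq_ltn.
case/orP=> h; last by rewrite ifT ?mulr0 //; nia.
rewrite ifF; last by nia.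
by rewrite ['C(b, _)]bin_small ?mulr0 //; nia.
Qed.

(** Size count for a product A^h B with A and B of degree at most d = q / p, where p = 2h + 1: the
    result has size at most q. *)
Lemma half_degree_bound h d a b c : (0 < h)%N -> (0 < d)%N ->
  (a <= (b.-1 * h).+1)%N -> (b <= d.+1)%N -> (c <= d.+1)%N ->
  ((a + c).-1 <= h.*2.+1 * d)%N.
Proof.
move=> h0 d0 Ha Hb Hc; have bh : (b.-1 * h <= d * h)%N by rewrite leq_mul2r; lia.
have dh : (0 < d * h)%N by rewrite muln_gt0 d0.
rewrite mulSn -muln2 mulnAC [(h * d)%N]mulnC; lia.
Qed.

(** * Binomial coefficients of (q - 1)/2 modulo p *)

Section HalfBinomials.
Variables (F : fieldType) (p : nat).
Hypotheses (chp : p \in [pchar F]) (oddp : odd p).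
Let h := p./2.
Let mr r := (p ^ r).-1./2.

(** Iterating this, all r base-p digits of (p^r - 1)/2 equal h = (p - 1)/2. *)
Lemma half_powS r : mr r.+1 = (mr r * p + h)%N.
Proof.
rewrite /mr /h expnS; have : (0 < p ^ r)%N by rewrite expn_gt0 prime_gt0 ?(pcharf_prime chp).
have : odd (p ^ r) by rewrite oddX oddp orbT.
have := odd_double_half p; rewrite oddp.
set n := (p ^ r)%N => <- on n0; rewrite -(odd_double_half n) on.
move: (p./2) (n./2) => u v; nia.
Qed.

Lemma half_prime_gt0 : (0 < h)%N.
Proof. have := prime_gt1 (pcharf_prime chp); have := oddp; rewrite /h; lia. Qed.

Lemma half_prime_ltn : (h < p)%N.
Proof. have := prime_gt1 (pcharf_prime chp); rewrite /h; lia. Qed.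

Lemma half_prime_neq0 : h%:R != 0 :> F.
Proof.
rewrite -(dvdn_pcharf chp); apply/negP => /(dvdn_leq half_prime_gt0).
by rewrite leqNgt half_prime_ltn.
Qed.

Lemma bin_half_digit r c i : (i < r)%N -> (c <= h)%N -> 'C(h, c)%:R != 0 :> F ->
  'C(mr r, c * p ^ i)%:R != 0 :> F.
Proof.
move=> ltir lec nz; have hp := half_prime_ltn; have p0 := leq_ltn_trans (leq0n _) hp.
elim: r i ltir => // r IH [|i] lti; rewrite half_powS.
  by rewrite expn0 muln1 -[c]/(0 * p + c)%N lucas_step ?bin0 ?mul1r // (leq_ltn_trans lec).
rewrite expnSr mulnA -[(c * p ^ i * p)%N]addn0 lucas_step // bin0 mulr1; exact: IH.
Qed.

(** The lower index has digits h and 1 at distinct places, so by Lucas the coefficient is C(h, h)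
    C(h, 1) = h modulo p. *)
Lemma bin_half_two_digits r i j : (i < r)%N -> (j < r)%N -> i != j ->
  'C(mr r, h * p ^ i + p ^ j)%:R != 0 :> F.
Proof.
have hp := half_prime_ltn; have p0 := leq_ltn_trans (leq0n _) hp.
have h0 := half_prime_gt0.
have h1 : 'C(h, 1)%:R != 0 :> F by rewrite bin1 half_prime_neq0.
have hh : 'C(h, h)%:R != 0 :> F by rewrite binn oner_eq0.
elim: r i j => // r IH [|i] [|j] // lti ltj nij; rewrite half_powS.
- rewrite expn0 muln1 [X in 'C(_, X)]addnC expnSr lucas_step // mulf_neq0 //.
  by rewrite -[(p ^ j)%N]mul1n bin_half_digit.
- rewrite expn0 expnSr mulnA lucas_step ?mulf_neq0 ?bin_half_digit //.
  by rewrite prime_gt1 ?(pcharf_prime chp).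
- have -> : (h * p ^ i.+1 + p ^ j.+1 = (h * p ^ i + p ^ j) * p + 0)%N.
    by rewrite addn0 mulnDl !expnSr mulnA.
  by rewrite lucas_step // bin0 mulr1 IH.
Qed.

Lemma bin_half_overflow r : 'C(mr r.+1, h.+1)%:R = 0 :> F.
Proof.
have hp : (h.+1 < p)%N.
  by have := prime_gt1 (pcharf_prime chp); have := oddp; rewrite /h; lia.
rewrite half_powS -[h.+1]/(0 * p + h.+1)%N lucas_step ?[X in _ * X%:R]bin_small ?mulr0 //.
exact: ltnW.
Qed.

End HalfBinomials.

(** * From power sums to a single Frobenius monomial *)

Section Carlitz.
Variables (F : finFieldType) (p r : nat).
Hypotheses (chp : p \in [pchar F]) (cardF : #|F| = (p ^ r)%N) (oddF : odd #|F|).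
Let m := #|F|.-1./2.

Lemma frobenius_iter t : exists s : {rmorphism F -> F}, forall x, s x = x ^+ (p ^ t).
Proof.
elim: t => [|t [s sE]]; first by exists idfun => x; rewrite expn0 expr1.
by exists (pFrobenius_aut chp \o s) => x; rewrite /= sE pFrobenius_autE -exprM -expnSr.
Qed.

Lemma exponent_gt0 : (0 < r)%N.
Proof. by have := card_field_gt1 F; rewrite cardF; case: (r). Qed.

Lemma odd_char : odd p.
Proof. by have := oddF; rewrite cardF oddX eqn0Ngt exponent_gt0. Qed.

Definition qchar_preserving (f : F -> F) :=
  forall x y, (f x - f y) ^+ m = (x - y) ^+ m.

(** The m-th powers are 0, 1 or -1, and each is fixed by the odd power p^i. *)
Lemma qchar_preserving_frobenius f i :
  qchar_preserving f -> qchar_preserving (fun x => f x ^+ (p ^ i)).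
Proof.
move=> fq x y; have [s sE] := frobenius_iter i.
rewrite -!sE -rmorphB sE -exprM mulnC exprM fq.
have [->|] := eqVneq (x - y) 0.
  have pi0 : (0 < p ^ i)%N by rewrite expn_gt0 prime_gt0 ?(pcharf_prime chp).
  by rewrite -exprM !expr0n muln_eq0 [(p ^ i == 0)%N]eqn0Ngt pi0 orbF.
case/(expf_half_cases oddF) => ->; rewrite ?expr1n // -signr_odd oddX odd_char orbT //.
Qed.

Lemma interp_coef_sum (f : F -> F) (P : {poly F}) e :
  (size P <= #|F|)%N -> (forall x, P.[x] = f x) -> (0 < e < #|F|)%N ->
  P`_e = - \sum_x f x * x ^+ (#|F|.-1 - e).
Proof.
move=> sP Pf he; rewrite -[LHS]opprK -(sum_horner_expf sP he); congr (- _).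
by apply: eq_bigr => x _; rewrite Pf.
Qed.

(** The moment identity is taken at k = q - e, which is nonzero in F since p divides q but not e. *)
Lemma qchar_preserving_sum_coprime f e : qchar_preserving f ->
  (1 < e < #|F|)%N -> ~~ (p %| e)%N -> \sum_x f x * x ^+ (#|F|.-1 - e) = 0.
Proof.
move=> fq /andP[e1 eq] pe; pose k := (#|F| - e)%N.
have hk : (0 < k < #|F|.-1)%N by rewrite /k; lia.
have := sum_moment1 oddF fq hk => /eqP; rewrite mulf_eq0 -(dvdn_pcharf chp).
have -> : k.-1 = (#|F|.-1 - e)%N by rewrite /k; lia.
have -> : (p %| k)%N = false.
  rewrite /k dvdn_subr ?(ltnW eq) ?(negPf pe) // cardF dvdn_exp ?exponent_gt0 //.
by move/eqP.
Qed.

(* Twisting f by Frobenius divides the exponent by p^t, so only e = p^t survives. *)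
Lemma qchar_preserving_sum0 f e : qchar_preserving f -> f 0 = 0 ->
  (0 < e < #|F|)%N -> (forall t, (t < r)%N -> e != (p ^ t)%N) ->
  \sum_x f x * x ^+ (#|F|.-1 - e) = 0.
Proof.
move=> fq f0 /andP[e0 eq] ne; have p_pr := pcharf_prime chp.
have [e' cpe' eE] := pfactor_coprime p_pr e0; set t := logn p e in eE.
have e'0 : (0 < e')%N by move: e0; rewrite eE muln_gt0 => /andP[].
have pt0 : (0 < p ^ t)%N by rewrite expn_gt0 prime_gt0.
have ltr : (t < r)%N.
  rewrite -(ltn_exp2l _ _ (prime_gt1 p_pr)) -cardF (leq_ltn_trans _ eq) // eE.
  by rewrite leq_pmull.
have e'1 : (1 < e')%N.
  rewrite ltn_neqAle e'0 andbT; apply: contraNneq (ne t ltr) => e'1.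
  by rewrite eE -e'1 mul1n.
have e'q : (e' < #|F|)%N by rewrite (leq_ltn_trans _ eq) // eE leq_pmulr.
have := qchar_preserving_sum_coprime (qchar_preserving_frobenius (r - t) fq).
move/(_ e'); rewrite e'1 e'q -prime_coprime // cpe' => /(_ isT isT) H.
(* Raising the vanishing sum for e' to the power p^t turns f x^(p^(r - t)) into f x^q = f x, and (q
   - 1 - e') p^t is congruent to q - 1 - e modulo q - 1. At x = 0 the congruence says nothing, and
   [f 0 = 0] is used. *)
have [s sE] := frobenius_iter t.
have : s (\sum_x f x ^+ (p ^ (r - t)) * x ^+ (#|F|.-1 - e')) = 0 by rewrite H rmorph0.
rewrite rmorph_sum => {2}<-; apply: eq_bigr => x _; rewrite sE exprMn -!exprM -expnD subnK ?(ltnW ltr) //.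
rewrite -cardF expf_card; have [->|x0] := eqVneq x 0; first by rewrite f0 !mul0r.
congr (_ * _); apply: (mulIf (expf_neq0 e x0)).
rewrite -!exprD subnK; last by lia.
rewrite expf_card_pred // [X in (_ + X)%N]eE -mulnDl subnK; last by lia.
by rewrite exprM expf_card_pred // expr1n.
Qed.

Lemma expf_exp_mod (x : F) n : x ^+ (p ^ n) = x ^+ (p ^ (n %% r)).
Proof.
rewrite {1}(divn_eq n r); elim: (n %/ r)%N => [//|k IH].
by rewrite mulSn -addnA expnD exprM -cardF expf_card.
Qed.

Lemma qchar_preserving_linearized f (P : {poly F}) : qchar_preserving f -> f 0 = 0 ->
  (size P <= #|F|)%N -> (forall x, P.[x] = f x) ->
  P = \sum_(s < r) P`_(p ^ s) *: 'X^(p ^ s).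
Proof.
move=> fq f0 sP Pf; have p1 := prime_gt1 (pcharf_prime chp).
apply/polyP => e; rewrite coef_sum.
under eq_bigr do rewrite coefZ coefXn.
have [/existsP[t /eqP et]|/existsPn ne] := boolP [exists t : 'I_r, e == p ^ t]%N.
  rewrite (bigD1 t) //= et eqxx mulr1 big1 ?addr0 // => s st.
  by rewrite (inj_eq (expnI p1)) eq_sym val_eqE (negPf st) mulr0.
rewrite big1 => [|s _]; last by rewrite (negPf (ne s)) mulr0.
case: (posnP e) => [->|e0]; first by rewrite -horner_coef0 Pf.
have [ltq|leq] := ltnP e #|F|; last by rewrite nth_default // (leq_trans sP).
rewrite (interp_coef_sum sP Pf) ?e0 // qchar_preserving_sum0 ?e0 ?oppr0 //.
by move=> t ltr; apply: (ne (Ordinal ltr)).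
Qed.

(* Let b_s be the coefficient of x^(p^s) and h = (p - 1)/2.  With i = -t and j = -u
   mod r, the coefficient of x^(h + 1) in f^(h p^i + p^j) is b_t^(h p^i) b_u^(p^j),
   and p divides C(m, h + 1) but not C(m, h p^i + p^j). *)
Lemma qchar_preserving_monomial f (P : {poly F}) (t u : 'I_r) : qchar_preserving f -> f 0 = 0 ->
  (size P <= #|F|)%N -> (forall x, P.[x] = f x) ->
  P`_(p ^ t) != 0 -> P`_(p ^ u) != 0 -> t = u.
Proof.
move=> fq f0 sP Pf nzt nzu; apply/eqP/contraT => ntu.
have p1 := prime_gt1 (pcharf_prime chp); have r0 := exponent_gt0.
pose h := p./2; have h0 := half_prime_gt0 chp odd_char.
pose i := ((r - t) %% r)%N; pose j := ((r - u) %% r)%N.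
have lti : (i < r)%N by rewrite ltn_mod. have ltj : (j < r)%N by rewrite ltn_mod.
(* With n = -a modulo r, the term of index b in [Q n] below is constant exactly when b = a. *)
have wrap (a b : 'I_r) : ((b + (r - a) %% r) %% r == 0)%N = (b == a).
  rewrite -val_eqE /=; move: (val a) (val b) (ltn_ord a) (ltn_ord b); clear => c d ltc ltd.
  have [->|c0] := posnP c; first by rewrite subn0 modnn addn0 modn_small.
  rewrite (@modn_small (r - c)); last by lia.
  have [lecd|ltdc] := leqP c d; last by rewrite modn_small; lia.
  have -> : (d + (r - c) = d - c + r)%N by lia.
  by rewrite modnDr modn_small; lia.
have nij : i != j.
  by apply: contraNneq ntu => ij; rewrite eq_sym -wrap -/i ij wrap.
(* X * [Q n] is f^(p^n) with exponents reduced by x^q = x. All of them are powers of p, hence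
   positive, so a factor X splits off. *)
pose Q n : {poly F} := \sum_(s < r) P`_(p ^ s) ^+ (p ^ n) *: 'X^((p ^ ((s + n) %% r)).-1).
have XQ n x : ('X * Q n).[x] = f x ^+ (p ^ n).
  have [s sE] := frobenius_iter n.
  rewrite -Pf (qchar_preserving_linearized fq f0 sP Pf) -sE !horner_sum rmorph_sum hornerM horner_sum mulr_sumr.
  apply: eq_bigr => v _; rewrite !hornerE rmorphM /= !sE.
  by rewrite [x * _]mulrC -mulrA -exprS prednK ?expn_gt0 ?(ltnW p1) // -expf_exp_mod expnD exprM.
have Q0 n (a : 'I_r) : n = ((r - a) %% r)%N -> (Q n).[0] = P`_(p ^ a) ^+ (p ^ n).
  move=> nE; rewrite horner_sum (bigD1 a) //= big1 ?addr0 => [|b ba].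
    rewrite !hornerE nE (eqP (_ : (a + (r - a) %% r) %% r == 0)%N) ?wrap //.
    by rewrite expn0 expr0n mulr1.
  rewrite !hornerE expr0n nE.
  have -> : ((p ^ ((b + (r - a) %% r) %% r)).-1 == 0)%N = false.
    move: (wrap a b); rewrite (negPf ba); case: (_ %% r)%N => // c _.
    have : (1 < p ^ c.+1)%N by rewrite -(expn0 p) ltn_exp2l.
    by move: (p ^ c.+1)%N; clear; lia.
  by rewrite mulr0.
pose G := ('X * Q i) ^+ h * ('X * Q j).
have GE : G = 'X^(h.+1) * (Q i ^+ h * Q j).
  by rewrite /G exprMn exprS; ring.
have Gf x : G.[x] = f x ^+ (h * p ^ i + p ^ j).
  by rewrite hornerM horner_exp !XQ -exprM mulnC -exprD mulnC.
have sXQ n : (size ('X * Q n)%R <= (p ^ r.-1).+1)%N.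
  rewrite (leq_trans (size_polyMleq _ _)) // size_polyX /=.
  rewrite ltnS; apply: (leq_trans (size_sum _ _ _)); apply/bigmax_leqP => s _.
  apply: (leq_trans (size_scale_leq _ _)); rewrite size_polyXn prednK ?expn_gt0 ?(ltnW p1) //.
  by rewrite leq_exp2l // -ltnS prednK // ltn_mod.
have pr : (p ^ r = p * p ^ r.-1)%N by rewrite -expnS prednK.
have p2h : p = (h.*2).+1 by rewrite -[LHS]odd_double_half odd_char.
have pr0 : (0 < p ^ r.-1)%N by rewrite expn_gt0 (ltnW p1).
have sG : (size G <= #|F|)%N.
  rewrite cardF pr [X in (_ <= X * _)%N]p2h (leq_trans (size_polyMleq _ _)) //.
  exact: (half_degree_bound h0 pr0 (size_poly_exp_leq _ _) (sXQ i) (sXQ j)).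
have he : (0 < h.+1 < #|F|)%N.
  by rewrite cardF pr [X in (_ < _ < X * _)%N]p2h; move: h0 pr0; rewrite -/h; clear; nia.
have mE : #|F|.-1./2 = (p ^ r).-1./2 by rewrite cardF.
have Ck : 'C(m, h * p ^ i + p ^ j)%:R != 0 :> F.
  by rewrite /m mE bin_half_two_digits ?odd_char.
have Ce : 'C(m, h.+1)%:R = 0 :> F.
  by rewrite /m mE -(prednK r0) bin_half_overflow ?odd_char.
(* The sum is minus the coefficient of X^(h + 1) in [G], that is of the constant term of Q_i^h Q_j,
   a product of powers of two nonzero coefficients. *)
have := qchar_preserving_binomial oddF fq he Ck Ce.
under eq_bigr do rewrite -Gf.
rewrite (sum_horner_expf sG he) => /eqP; rewrite oppr_eq0 GE coefXnM ltnn subnn.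
rewrite -horner_coef0 hornerM horner_exp (Q0 i t) // (Q0 j u) //.
by rewrite mulf_eq0 !expf_eq0 (negPf nzt) (negPf nzu) !andbF.
Qed.

Theorem carlitz f : qchar_preserving f ->
  exists (t : F) (s : {rmorphism F -> F}), nzsq t /\ forall x, f x = t * s x + f 0.
Proof.
move=> fq; pose g x := f x - f 0.
have gq : qchar_preserving g by move=> x y; rewrite /g opprB addrA subrK fq.
have g0 : g 0 = 0 by rewrite /g subrr.
have [P [sP Pg]] := interpolation g.
have Plin := qchar_preserving_linearized gq g0 sP Pg.
have [/existsP[t nzt]|/existsPn z] := boolP [exists t : 'I_r, P`_(p ^ t) != 0]; last first.
  have P0 : P = 0.
    by rewrite Plin big1 // => s _; move: (z s); rewrite negbK => /eqP ->; rewrite scale0r.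
  have := oner_neq0 F; rewrite (qchar_preserving_inj oddF gq (_ : g 1 = g 0)) ?eqxx //.
  by rewrite -!Pg P0 !horner0.
have [s sE] := frobenius_iter t.
have gE x : g x = P`_(p ^ t) * s x.
  rewrite -Pg {1}Plin horner_sum (bigD1 t) //= big1 ?addr0 => [|u ut]; first by rewrite !hornerE sE.
  rewrite !hornerE; have [->|nzu] := eqVneq P`_(p ^ u) 0; first by rewrite mul0r.
  by rewrite (qchar_preserving_monomial gq g0 sP Pg nzu nzt) eqxx in ut.
exists P`_(p ^ t), s; split; last by move=> x; rewrite -gE /g subrK.
(* The leading factor is a difference of values of g, so its m-th power is (1 - 0)^m = 1. *)
have -> : P`_(p ^ t) = g 1 - g 0 by rewrite g0 subr0 gE rmorph1 mulr1.
by rewrite nzsqE // gq subr0 expr1n.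
Qed.

End Carlitz.

(** * Layers of the covering graphs *)

(** The middle binomial coefficients are divisible by l. The ring is not assumed commutative because
    the lemma is applied to matrices. *)
Lemma exprD_comm_prime (R : pzRingType) (l : nat) (x y : R) : prime l ->
  (forall z : R, z *+ l = 0) -> GRing.comm x y -> (x + y) ^+ l = x ^+ l + y ^+ l.
Proof.
move=> l_pr l0 cxy; have l1 := prime_gt0 l_pr.
rewrite exprDn_comm // (bigD1 ord0) //= (bigD1 ord_max) /=; last by rewrite -val_eqE /= -lt0n.
rewrite bin0 binn subn0 subnn !expr0 mulr1 mul1r !mulr1n big1 ?addr0 // => i /andP[i0 il].
have /dvdnP[c ->] : (l %| 'C(l, i))%N.
  rewrite prime_dvd_bin // lt0n [X in X && _]i0 /= ltn_neqAle [X in X && _]il.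
  by rewrite -ltnS ltn_ord.
by rewrite mulrnA l0.
Qed.

Lemma expr_sum_comm_prime (R : pzRingType) (l : nat) (I : Type) (s : seq I) (P : pred I)
    (A : I -> R) : prime l -> (forall z : R, z *+ l = 0) ->
  (forall i j, GRing.comm (A i) (A j)) ->
  (\sum_(i <- s | P i) A i) ^+ l = \sum_(i <- s | P i) A i ^+ l.
Proof.
move=> l_pr l0 cA; elim: s => [|i s IH].
  by rewrite !big_nil expr0n eqn0Ngt prime_gt0.
rewrite !big_cons; case: ifP => // Pi; rewrite exprD_comm_prime ?IH //.
by apply: GRing.commr_sum => j _; apply: cA.
Qed.

(** * Matrices of relations and of translations *)

Section RelationMatrix.
Variables (V : finType) (K : nzRingType).

Definition relmx (M : V -> V -> K) : 'M[K]_#|V| :=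
  \matrix_(i, j) M (enum_val i) (enum_val j).

Lemma relmxE M u v : relmx M (enum_rank u) (enum_rank v) = M u v.
Proof. by rewrite mxE !enum_rankK. Qed.

Lemma relmxM M N : relmx M * relmx N = relmx (fun u v => \sum_w M u w * N w v).
Proof.
apply/matrixP => i j; rewrite !mxE [RHS]big_enum_val /=.
by apply: eq_bigr => k _; rewrite !mxE.
Qed.

(** Entries of powers are weighted walk counts, and f relabels the intermediate vertices. *)
Lemma relmx_exp_bij (M N : V -> V -> K) (f : V -> V) k u v : injective f ->
  (forall u v, M (f u) (f v) = N u v) ->
  (relmx M ^+ k) (enum_rank (f u)) (enum_rank (f v)) =
  (relmx N ^+ k) (enum_rank u) (enum_rank v).
Proof.
move=> f_inj MN; elim: k u => [|k IH] u.
  by rewrite !expr0 !mxE !(inj_eq enum_rank_inj) (inj_eq f_inj).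
rewrite !exprS !mxE.
have h_inj : injective (fun j : 'I_#|V| => enum_rank (f (enum_val j))).
  by move=> i j /enum_rank_inj/f_inj/enum_val_inj.
rewrite (reindex_inj h_inj) /=; apply: eq_bigr => j _.
by rewrite IH enum_valK !mxE !enum_rankK MN.
Qed.

End RelationMatrix.

Section Translations.
Variables (A B : finZmodType) (K : nzRingType).
Local Notation V := (A * B)%type.

Definition translmx (w : V) : 'M[K]_#|{: V}| := relmx (fun u v : V => (v == u + w)%:R).

Lemma translmxD (w w' : V) : translmx (w + w') = translmx w * translmx w'.
Proof.
rewrite relmxM; apply/matrixP => i j; rewrite !mxE.
rewrite (bigD1 (enum_val i + w)) //= eqxx mul1r addrA big1 ?addr0 // => u nu.
by rewrite (negPf nu) mul0r.
Qed.

Lemma translmx_exp (w : V) k : translmx w ^+ k = translmx (w *+ k).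
Proof.
elim: k => [|k IH]; last by rewrite exprS IH mulrS translmxD.
apply/matrixP => i j; rewrite !mxE addr0.
by rewrite (inj_eq enum_val_inj) eq_sym.
Qed.

Lemma translmx_comm (w w' : V) : GRing.comm (translmx w) (translmx w').
Proof. by rewrite /GRing.comm -!translmxD addrC. Qed.

End Translations.

(** * The l-th power of the adjacency matrix *)

Section Powers.
Variables (F : finFieldType) (l : nat).
Hypotheses (l_pr : prime l) (lF : l%:R != 0 :> F).

Lemma Zp_mulrn (x : 'Z_l) : x *+ l = 0.
Proof. by rewrite -mulr_natl pchar_Zp ?mul0r // prime_gt1. Qed.

(** The Cayley graph with connection set {(l s, 0)}: the voltages disappear because l * alpha s =
    0. *)
Definition ladj (u v : F * 'Z_l) := nzsq ((v.1 - u.1) / l%:R) && (v.2 == u.2).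

(* Frobenius on the commuting translations: modulo l, the number of walks of length l
   from u to v is the adjacency of the Cayley graph of {l s}. *)
Lemma walk_count_mod (alpha : F -> 'Z_l) u v :
  (relmx (fun u v : F * 'Z_l => (Xadj alpha u v)%:R : 'F_l) ^+ l) (enum_rank u) (enum_rank v) =
  (ladj u v)%:R.
Proof.
have -> : relmx (fun u v : F * 'Z_l => (Xadj alpha u v)%:R : 'F_l) =
          \sum_(s | nzsq s) translmx _ ((s, alpha s) : F * 'Z_l).
  apply/matrixP => i j; rewrite summxE mxE; set a := enum_val i; set b := enum_val j.
  rewrite /Xadj; have [sq|nsq] /= := boolP (nzsq (b.1 - a.1)); last first.
    rewrite big1 // => s sqs; rewrite mxE; case: eqP => // e.
    by move: nsq; rewrite /b e /= addrC addKr sqs.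
  rewrite (bigD1 (b.1 - a.1)) //= [X in _ = _ + X]big1 ?addr0 => [|s /andP[_ ns]].
    rewrite mxE -/a -/b; clearbody a b; case: a b {sq} => a1 a2 [b1 b2] /=.
    rewrite -[(a1, a2) + _]/(a1 + (b1 - a1), a2 + alpha (b1 - a1)) xpair_eqE.
    by rewrite [a1 + _]addrC subrK eqxx subr_eq [a2 + _]addrC.
  rewrite mxE -/a -/b; case: eqP => // e.
  by move: ns; rewrite e /= addrC addKr eqxx.
rewrite expr_sum_comm_prime //; first last.
- by move=> s s'; apply: translmx_comm.
- by move=> A; apply/matrixP => i j; rewrite mulmxnE mxE -mulr_natl pchar_Fp_0 // mul0r.
under eq_bigr do rewrite translmx_exp.
rewrite summxE; under eq_bigr do rewrite relmxE.
rewrite /ladj; set d := _ / _.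
have vE s : (v == u + (s, alpha s) *+ l) = (s == d) && (v.2 == u.2).
  rewrite [v]surjective_pairing [u]surjective_pairing.
  have -> : (s, alpha s) *+ l = (s *+ l, alpha s *+ l) :> F * 'Z_l.
    by rewrite [LHS]surjective_pairing !raddfMn.
  rewrite xpair_eqE /= Zp_mulrn addr0; congr (_ && _).
  rewrite /d -[RHS](inj_eq (mulIf lF)) divfK // mulr_natr.
  by rewrite [u.1 + _]addrC -subr_eq eq_sym.
under eq_bigr do rewrite vE.
have [sq|nsq] /= := boolP (nzsq d).
  rewrite (bigD1 d) //= eqxx big1 ?addr0 // => s /andP[_ /negPf ->] //.
rewrite big1 // => s sqs; case: eqP => // sd.
by move: nsq; rewrite -sd sqs.
Qed.

(** The isomorphism carries the l-th power of one adjacency matrix to that of the other, and modulo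
    l both are the 0/1 matrix of [ladj]. *)
Lemma ladj_iso (alpha beta : F -> 'Z_l) f :
  graph_iso alpha beta f -> forall u v, ladj (f u) (f v) = ladj u v.
Proof.
case=> /bij_inj f_inj fadj u v.
have adjE u' v' : (Xadj beta (f u') (f v'))%:R = (Xadj alpha u' v')%:R :> 'F_l by rewrite fadj.
pose M g (u v : F * 'Z_l) : 'F_l := (Xadj g u v)%:R.
have := relmx_exp_bij (M := M beta) (N := M alpha) l u v f_inj adjE; rewrite !walk_count_mod.
by case: (ladj (f u) _); case: (ladj u v) => // /eqP; rewrite ?oner_eq0 // eq_sym oner_eq0.
Qed.

End Powers.

Lemma Zp_prime_unit l (x : 'Z_l) : prime l -> x != 0 -> x \is a GRing.unit.
Proof.
move=> l_pr x0; have l1 := prime_gt1 l_pr.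
rewrite -[x]natr_Zp unitZpE // prime_coprime // gtnNdvd //; last first.
  by rewrite -[X in (_ < X)%N](Zp_cast l1) ltn_ord.
by rewrite lt0n; apply: contraNneq x0 => x0; apply/eqP/val_inj.
Qed.

(** * Action of an isomorphism on the layers *)

Section Fibers.
Variables (F : finFieldType) (p r l : nat).
Hypotheses (chp : p \in [pchar F]) (cardF : #|F| = (p ^ r)%N) (oddF : odd #|F|).
Hypotheses (l_pr : prime l) (lp : l != p).
Variables (alpha beta : F -> 'Z_l) (f : F * 'Z_l -> F * 'Z_l).
Hypothesis fiso : graph_iso alpha beta f.

Lemma coprime_char_neq0 : l%:R != 0 :> F.
Proof. by rewrite -(dvdn_pcharf chp) dvdn_prime2 ?(pcharf_prime chp) // eq_sym. Qed.

Let lF := coprime_char_neq0.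
Let fl := ladj_iso l_pr lF fiso.
Let f_inj : injective f := bij_inj fiso.1.

Lemma iso_layer x i : (f (x, i)).2 = (f (0, i)).2.
Proof.
have step y d : (f (y + d ^+ 2 * l%:R, i)).2 = (f (y, i)).2.
  have [->|d0] := eqVneq d 0; first by rewrite expr0n mul0r addr0.
  have : ladj (y, i) (y + d ^+ 2 * l%:R, i).
    rewrite /ladj /= eqxx andbT [y + _]addrC addrK mulfK // /nzsq expf_neq0 //.
    by apply/existsP; exists d.
  by rewrite -fl => /andP[_ /eqP].
have n2 : 2%:R != 0 :> F.
  apply: contraNneq (neg1_neq1 oddF) => e; rewrite eq_sym -subr_eq0 opprK.
  by rewrite -e mulr2n.
(* Chosen so that a^2 - b^2 = x / l: then l a^2 = x + l b^2 is reached from both 0 and x by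
   [step]. *)
pose a := (x / l%:R + 1) / 2%:R; pose b := (x / l%:R - 1) / 2%:R.
rewrite -(step 0 a) -(step x b); congr (f (_, i)).2.
have xE : x = x / l%:R * l%:R by rewrite divfK.
rewrite add0r {1}xE -mulrDl; congr (_ * _); rewrite /a /b.
by move: (x / l%:R) => z; field; rewrite n2.
Qed.

(** [ladj] tests whether a difference divided by l is a square; the character of l occurs on both
    sides and cancels. *)
Lemma iso_layer_qchar i : qchar_preserving (fun x => (f (x, i)).1).
Proof.
move=> x y; have [->|nxy] := eqVneq x y; first by rewrite !subrr.
have d0 : x - y != 0 by rewrite subr_eq0.
have fd0 : (f (x, i)).1 - (f (y, i)).1 != 0.
  rewrite subr_eq0; apply: contraNneq nxy => e.
  suff /f_inj[->] : f (x, i) = f (y, i) by [].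
  rewrite [LHS]surjective_pairing [RHS]surjective_pairing e.
  by rewrite (iso_layer x) (iso_layer y).
have := fl (y, i) (x, i); rewrite /ladj (iso_layer x) (iso_layer y) !eqxx !andbT /=.
rewrite !nzsqE // !exprMn exprVn.
set u := l%:R ^+ _; have u0 : u != 0 by rewrite expf_neq0.
have [eu|eu] := expf_half_cases oddF lF; rewrite -/u in eu; rewrite eu ?invrN ?invr1 ?mulr1 ?mulrN1;
have [->|->] := expf_half_cases oddF d0; have [->|->] := expf_half_cases oddF fd0;
by rewrite ?opprK ?eqxx ?(negPf (neg1_neq1 oddF)).
Qed.

Hypothesis (ha : voltage alpha).

(** A nonzero voltage e generates Z/l, so every layer is reached from layer 0 in steps of e, and the
    edges of each step force equal linear parts. *)
Lemma iso_common_linear_part : exists (t : F) (s : {rmorphism F -> F}),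
  nzsq t /\ forall x i, (f (x, i)).1 = t * s x + (f (0, i)).1.
Proof.
have [[s0 /andP[sq0 a0]] _] := ha; set e := alpha s0 in a0.
have [t [s [tsq tE]]] := carlitz chp cardF oddF (iso_layer_qchar 0).
exists t, s; split=> // x i.
have -> : i = e *+ val (e^-1 * i).
  by rewrite -mulr_natr natr_Zp mulVKr // Zp_prime_unit.
elim: (val _) x => [|k IH] x; first exact: tE.
set j := e *+ k in IH *; have -> : e *+ k.+1 = j + e by rewrite mulrSr.
have [t' [s' [_ tE']]] := carlitz chp cardF oddF (iso_layer_qchar (j + e)).
rewrite tE'; congr (_ + _).
(* The constant is what remains of the difference of the images of (y, j) and (y + s0, j + e) once
   the terms in y are removed. *)
apply: (@semilinear_diff_nzsq F oddF s' s t' t (t' * s' s0 + (f (0, j + e)).1 - (f (0, j)).1)).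
move=> y; have : Xadj alpha (y, j) (y + s0, j + e).
  by rewrite /Xadj /= ![_ + _ - _]addrAC !subrr !add0r sq0 /=.
rewrite -fiso.2 => /andP[+ _]; rewrite tE' IH rmorphD /=.
by congr (is_true (nzsq _)); ring.
Qed.

End Fibers.

(** * Sylow correction *)

Section Sylow.
Variables (F : finFieldType) (p l : nat).
Hypotheses (chp : p \in [pchar F]) (l_pr : prime l) (lp : l != p).
Local Notation V := (F * 'Z_l)%type.

Definition layer_translation (g : V -> V) :=
  forall x i, g (x, i) = (x + (g (0, i)).1, (g (0, i)).2).

Lemma layer_translation_comp (g h : V -> V) :
  layer_translation g -> layer_translation h -> layer_translation (g \o h).
Proof.
move=> gT hT x i /=; rewrite hT [g (x + _, _)]gT [g (h _)](_ : _ = g ((h (0, i)).1, (h (0, i)).2)).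
  by rewrite [in RHS]gT /= addrA.
by rewrite -surjective_pairing.
Qed.

Lemma layer_translation_can (g h : V -> V) :
  cancel g h -> cancel h g -> layer_translation g -> layer_translation h.
Proof.
move=> gK hK gT x i; apply: (can_inj gK); rewrite hK gT.
have := hK (0, i); rewrite [h (0, i)]surjective_pairing gT /= => -[e1 e2].
by rewrite -addrA e1 addr0 e2.
Qed.

Definition layer_aut (beta : F -> 'Z_l) : {set {perm V}} :=
  [set g : {perm V} | [forall u, forall v, Xadj beta (g u) (g v) == Xadj beta u v] &&
           [forall x, forall i, g (x, i) == (x + (g (0, i)).1, (g (0, i)).2)%R]].

Lemma layer_autP beta (g : {perm V}) :
  reflect ((forall u v, Xadj beta (g u) (g v) = Xadj beta u v) /\ layer_translation g)
          (g \in layer_aut beta).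
Proof.
rewrite inE; apply: (iffP andP) => -[H1 H2]; split.
- by move=> u v; move/forallP/(_ u)/forallP/(_ v)/eqP: H1.
- by move=> x i; move/forallP/(_ x)/forallP/(_ i)/eqP: H2.
- by apply/forallP => u; apply/forallP => v; rewrite H1.
- by apply/forallP => x; apply/forallP => i; apply/eqP.
Qed.

Lemma layer_aut_group_set beta : group_set (layer_aut beta).
Proof.
apply/group_setP; split=> [|g h /layer_autP[g1 g2] /layer_autP[h1 h2]]; apply/layer_autP.
  by split=> [u v|x i]; rewrite !perm1 ?addr0.
split=> [u v|x i]; first by rewrite !permM h1 g1.
by rewrite !permM; apply: (layer_translation_comp h2 g2).
Qed.

Canonical layer_aut_group beta := Group (layer_aut_group_set beta).

Lemma layer_perm_inj (g : {perm V}) : layer_translation g ->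
  injective (fun i => (g (0, i)).2).
Proof.
move=> gT i j /= e; set d := (g (0, i)).1 - (g (0, j)).1.
have /perm_inj[_ ->] // : g (0, i) = g (d, j).
by rewrite [RHS]gT subrK -e -surjective_pairing.
Qed.

(** The default 1 makes this total on permutations whose map on layers is not injective. *)
Definition layer_perm (g : {perm V}) : {perm 'Z_l} :=
  if injectiveP (fun i : 'Z_l => (g (0, i)).2) is ReflectT g_inj then perm g_inj else 1%g.

Lemma layer_permE (g : {perm V}) i : layer_translation g ->
  layer_perm g i = (g (0, i)).2.
Proof.
move=> gT; rewrite /layer_perm; case: injectiveP => [g_inj|]; first by rewrite permE.
by case; apply: layer_perm_inj.
Qed.

Lemma layer_perm_morph beta :
  {in layer_aut beta &, {morph layer_perm : g h / (g * h)%g}}.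
Proof.
move=> g h gE hE; have [_ gT] := layer_autP _ _ gE; have [_ hT] := layer_autP _ _ hE.
have [_ ghT] := layer_autP _ _ (groupM gE hE).
apply/permP => i; rewrite permM !layer_permE // permM.
by rewrite [g (0, i)]surjective_pairing hT /=.
Qed.

(** Such a g adds a constant to each layer, and p times that constant is 0. *)
Lemma layer_perm_ker (g : {perm V}) : layer_translation g -> layer_perm g = 1%g ->
  (g ^+ p)%g = 1%g.
Proof.
move=> gT g1; have g2 i : (g (0, i)).2 = i by rewrite -layer_permE // g1 perm1.
apply/permP => -[x i]; rewrite permX perm1.
have -> : iter p g (x, i) = (x + (g (0, i)).1 *+ p, i).
  elim: p => [|k IH]; first by rewrite /= addr0.
  by rewrite iterS IH gT g2 mulrSr addrA.
by rewrite mulrn_pchar ?addr0.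
Qed.

(** Elements acting trivially on layers have order dividing p, so an l-group embeds into the
    symmetric group on Z/l, and l divides l! exactly once. *)
Lemma card_layer_lgroup beta (Q : {group {perm V}}) :
  Q \subset layer_aut beta -> (l.-group Q)%g -> (#|Q| %| l)%N.
Proof.
move=> sQE lQ; have l1 := prime_gt1 l_pr.
have QT g : g \in Q -> layer_translation g by move/(subsetP sQE)/layer_autP=> [].
have phiM : {in Q &, {morph layer_perm : g h / (g * h)%g}}.
  by move=> g h gQ hQ; apply: (@layer_perm_morph beta); apply: (subsetP sQE).
pose phi := Morphism phiM.
have phi_inj : ('injm phi)%g.
  apply/subsetP => g /morphpreP[gQ]; rewrite !inE => /eqP g1.
  have gp := layer_perm_ker (QT g gQ) g1.
  rewrite -order_eq1; have := order_dvdn g p; rewrite gp eqxx => og.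
  have lg : l.-nat #[g]%g := mem_p_elt lQ gQ.
  have : coprime #[g]%g p by rewrite (pnat_coprime lg) // p'natE // dvdn_prime2 ?(pcharf_prime chp).
  by rewrite /coprime (gcdn_idPl og).
have : (#|Q| %| l`!)%N.
  rewrite -(card_injm phi_inj (subxx Q)) -[X in (_ %| X`!)%N](Zp_cast l1) -card_Sn.
  by rewrite -cardsT cardSg ?subsetT.
have [k ->] := p_natP lQ.
rewrite pfactor_dvdn ?fact_gt0 // => lek; rewrite -[X in (_ %| X)%N]expn1 dvdn_exp2l //.
(* In Legendre's formula for l! only the first term is nonzero. *)
apply: (leq_trans lek); rewrite logn_fact // big_ltn ?ltnS ?prime_gt0 // expn1 divnn prime_gt0 //.
rewrite big_nat big1 // => i /andP[i1 _]; rewrite divn_small //.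
by rewrite -[X in (X < _)%N]expn1 ltn_exp2l.
Qed.

Lemma layer_Sylow beta (C : {group {perm V}}) :
  C \subset layer_aut beta -> #|C| = l -> (l.-Sylow(layer_aut beta) C)%g.
Proof.
move=> sCE cC.
have lC : (l.-group C)%g by rewrite /pgroup cC pnat_id.
have [Q sylQ sCQ] := Sylow_superset sCE lC.
suff -> : C = Q by [].
apply/val_inj/eqP; rewrite eqEcard sCQ cC dvdn_leq ?prime_gt0 //.
by apply: card_layer_lgroup (pHall_sub sylQ) (pHall_pgroup sylQ).
Qed.

Lemma shift_inj : injective (fun u : V => (u.1, u.2 + 1)).
Proof. by move=> [x i] [y j] /pair_eqP/andP[/eqP/= -> /eqP/addIr ->]. Qed.

(** A generator of the deck group Z/l. *)
Definition shift : {perm V} := perm shift_inj.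

Lemma shiftX k x i : (shift ^+ k)%g (x, i) = (x, i + k%:R).
Proof.
rewrite permX; elim: k => [|k IH]; first by rewrite /= addr0.
by rewrite iterS IH permE /= -addrA natr1.
Qed.

Lemma order_shift : #[shift]%g = l.
Proof.
apply: nt_prime_order => //.
  by apply/permP => -[x i]; rewrite shiftX perm1 pchar_Zp ?addr0 // prime_gt1.
apply/eqP => /permP/(_ (0, 0)); rewrite -[shift]expg1 shiftX perm1 => /pair_eqP/andP[_].
by rewrite /= add0r oner_eq0.
Qed.

Lemma shift_aut beta : shift \in layer_aut beta.
Proof.
apply/layer_autP; split=> [[x i] [y j]|x i]; rewrite !permE /= ?addr0 //.
by rewrite /Xadj /= [j + 1]addrC [i + 1]addrC opprD addrACA subrr add0r.
Qed.

Lemma layer_translation_iso (alpha beta : F -> 'Z_l) (f : V -> V) :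
  voltage alpha -> voltage beta -> graph_iso alpha beta f -> layer_translation f ->
  exists2 n : 'Z_l, n \is a GRing.unit & forall s, nzsq s -> n * alpha s = beta s.
Proof.
move=> ha hb [/bij_inj f_inj fadj] fT; pose h := perm f_inj.
have hT : layer_translation h by move=> x i; rewrite !permE fT.
have hadj u v : Xadj beta (h u) (h v) = Xadj alpha u v by rewrite !permE.
have hVT : layer_translation (h^-1)%g := layer_translation_can (permK h) (permKV h) hT.
(* Permutations compose from left to right, so [shift ^ h] applies h^-1, then the shift of X^alpha,
   then h: an automorphism of X^beta. *)
have zh : (shift ^ h)%g \in layer_aut beta.
  have [zadj zT] := layer_autP _ _ (shift_aut alpha).
  apply/layer_autP; split=> [u v|x i].
    by rewrite conjgE !permM hadj zadj -hadj !permKV.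
  rewrite conjgE !permM.
  exact: (layer_translation_comp hT (layer_translation_comp zT hVT)).
have sylz := layer_Sylow (_ : <[shift]>%g \subset layer_aut beta) order_shift.
have sylzh := layer_Sylow (_ : <[shift ^ h]>%g \subset layer_aut beta) (etrans (orderJ _ _) order_shift).
rewrite !cycle_subG in sylz sylzh.
(* Both cyclic groups are Sylow, so an automorphism k of X^beta conjugates one to the other, and h
   followed by k normalizes the deck group. *)
have [k kE /= eqz] := Sylow_trans (sylzh zh) (sylz (shift_aut beta)).
have [kadj kT] := layer_autP _ _ kE.
pose g := (h * k)%g.
have : (shift ^ g)%g \in <[shift]>%g.
  by rewrite eqz -cycleJ conjgM cycle_id.
case/cycleP=> n zn.
have gz u : g (shift u) = (shift ^+ n)%g (g u).
  by rewrite -zn conjgE [RHS]permM permK [RHS]permM.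
(* Commuting past the shift up to the exponent n determines g from its values on layer 0, where it
   is a translation. *)
have gE x i : g (x, i) = (x + (g (0, 0)).1, (g (0, 0)).2 + n%:R * i).
  have gT : layer_translation g.
    by move=> y j; rewrite !permM; apply: (layer_translation_comp kT hT).
  rewrite -[i]natr_Zp; elim: (val i) => [|m IH].
    by rewrite mulr0 addr0 -gT.
  have -> : (x, m.+1%:R) = shift (x, m%:R) by rewrite permE /= natr1.
  by rewrite gz IH shiftX -addrA -natr1 mulrDr mulr1.
move: (g (0, 0)).1 (g (0, 0)).2 gE => c d gE.
have gadj u v : Xadj beta (g u) (g v) = Xadj alpha u v.
  by rewrite [g u]permM [g v]permM kadj hadj.
have key s : nzsq s -> n%:R * alpha s = beta s.
  move=> sq; have : Xadj alpha (0, 0) (s, alpha s) by rewrite /Xadj /= !subr0 sq eqxx.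
  rewrite -gadj !gE /Xadj /= => /andP[_ /eqP].
  by rewrite mulr0 addr0 add0r addrK [_ + n%:R * _]addrC addrK.
exists n%:R => //; apply: Zp_prime_unit => //.
have [[s /andP[sq bs]] _] := hb.
by apply: contraNneq bs => n0; rewrite -key // n0 mul0r.
Qed.

End Sylow.

(** * Removal of the linear part and conclusion *)

Theorem theorem1p2 (F : finFieldType) (p r l : nat)
  (hp : prime p) (hchar : p \in [pchar F]) (hq : #|F| = (p ^ r)%N)
  (hq4 : (#|F| %% 4 = 1)%N) (hl : prime l) (hlp : l != p)
  (hrl : (r <= 4)%N \/ ((#|F| - 1) %/ 2 < l)%N)
  (alpha beta : F -> 'Z_l)
  (ha : voltage alpha) (hb : voltage beta)
  (hiso : graph_isomorphic alpha beta) :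
  exists (t : F) (sigma : {rmorphism F -> F}) (n : 'Z_l),
    nzsq t /\ bijective sigma /\ n \is a GRing.unit /\
    graph_iso alpha beta (fun u => (t * sigma u.1, n * u.2)) /\
    (forall s, nzsq s -> n * alpha s = beta (t * sigma s)) /\
    cover_isomorphic (fun s => n * alpha s) beta.
Proof.
have oddF : odd #|F| by move: hq4; clear; lia.
have [f fiso] := hiso.
have [t [s [tsq fE]]] := iso_common_linear_part hchar hq oddF hl hlp fiso ha.
have t0 : t != 0 by case/andP: tsq.
have ts_inj : injective (fun x => t * s x) by move=> x y /(mulfI t0)/fmorph_inj.
have [w tsK wK] := injF_bij ts_inj.
have sq_ts x : nzsq (t * s x) = nzsq x.
  by rewrite nzsq_mull // !nzsqE // -rmorphXn fmorph_eq1.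
(* The voltage [beta'] defined below is beta pulled back along x |-> t x^sigma; g is then an
   isomorphism from X^beta' to X^beta, and f followed by its inverse is a layer translation. *)
pose g (u : F * 'Z_l) := (t * s u.1, u.2).
pose g' (u : F * 'Z_l) := (w u.1, u.2).
have gK : cancel g g' by move=> [x i]; rewrite /g /g' /= tsK.
have g'K : cancel g' g by move=> [x i]; rewrite /g /g' /= wK.
pose beta' x := beta (t * s x).
have gadj u v : Xadj beta (g u) (g v) = Xadj beta' u v.
  by rewrite /Xadj /g /= -mulrBr -rmorphB sq_ts.
have f'iso : graph_iso alpha beta' (g' \o f).
  split=> [|u v]; last by rewrite -gadj /= !g'K fiso.2.
  by apply: bij_comp fiso.1; exists g.
have f'T : layer_translation (g' \o f).
  move=> x i; apply: (can_inj gK); rewrite /= g'K {1}/g /= rmorphD mulrDr wK.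
  by rewrite [LHS]surjective_pairing fE (iso_layer hchar oddF hl hlp fiso).
have hb' : voltage beta'.
  split=> [|x sqx]; last by rewrite /beta' rmorphN mulrN hb.2 ?sq_ts.
  have [[y /andP[sqy by0]] _] := hb.
  by exists (w y); rewrite -sq_ts /beta' wK sqy.
have [n un nE] := layer_translation_iso hchar hl hlp ha hb' f'iso f'T.
exists t, s, n; do !split=> //.
- by apply: injF_bij; apply: fmorph_inj.
- exists (fun u => (w u.1, n^-1 * u.2)) => -[x i] /=.
    by rewrite tsK mulKr.
  by rewrite wK mulVKr.
- move=> u v; rewrite /Xadj /= -!mulrBr -rmorphB sq_ts.
  by case: (boolP (nzsq _)) => //= sq; rewrite -[beta _]/(beta' _) -nE // (inj_eq (mulrI un)).
(* The map g leaves the second coordinate alone, so it commutes with Z/l, and n alpha agrees with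
   [beta'] on nonzero squares. *)
exists g; split; last by move=> x i j.
split=> [|u v]; first by exists g'.
rewrite gadj /Xadj; case: (boolP (nzsq _)) => //= sq.
by rewrite -nE.
Qed.
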